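(* There is an absolute constant $C>0$ such that for every graph $H$ with $t$ vertices, every graph $G$ that does not contain $H$ as an immersion is nonrepetitively $4^{t^4+Ct^2}$-colourable (i.e. has nonrepetitive chromatic number $4^{t^4+O(t^2)}$).
   Context: All graphs are finite and simple (no loops or parallel edges). A $k$-colouring of a graph $G$ is a function assigning one of $k$ colours to each vertex. A path $(v_1,\dots,v_{2s})$ of even order is repetitively coloured by $\psi$ if $\psi(v_i)=\psi(v_{s+i})$ for all $i\in\{1,\dots,s\}$; a colouring is nonrepetitive if no path of even order in $G$ is repetitively coloured. A graph $G$ contains $H$ as an immersion if the vertices of $H$ can be mapped to distinct vertices of $G$ and the edges of $H$ mapped to pairwise edge-disjoint paths of $G$ so that each edge $vw$ of $H$ is mapped to a path whose endpoints are the images of $v$ and $w$. *)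

(* Defs.v *)
From mathcomp Require Import all_boot.

Set Implicit Arguments.
Unset Strict Implicit.
Unset Printing Implicit Defensive.

Record sgraph := SGraph {
  vertex :> finType;
  adj : rel vertex;
  adj_sym : symmetric adj;
  adj_irr : irreflexive adj }.

Definition edges (G : sgraph) : {set {set G}} :=
  [set [set xy.1; xy.2] | xy : G * G & adj xy.1 xy.2].

(* A path has at least one vertex. Nonemptiness matters: the empty sequence has
   even length and would be repetitively coloured by every colouring. *)
Definition is_path (G : sgraph) (p : seq G) : bool :=
  [&& p != [::], uniq p & sorted (@adj G) p].

Definition path_edges (G : sgraph) (p : seq G) : seq {set G} :=
  [seq [set xy.1; xy.2] | xy <- zip p (behead p)].

(* The path may be listed from either end; as a path is nonempty, the default
   value of [head] and [last] plays no role. *)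
Definition path_between (G : sgraph) (u v : G) (p : seq G) : Prop :=
  is_path p /\ ((head u p = u /\ last u p = v) \/
                (head u p = v /\ last u p = u)).

Definition repetitively_coloured (G : sgraph) (K : Type) (psi : G -> K)
    (p : seq G) : Prop :=
  exists2 s : nat, size p = 2 * s &
    forall (x0 : G) (i : nat), i < s ->
      psi (nth x0 p i) = psi (nth x0 p (s + i)).

Definition nonrepetitive (G : sgraph) (K : Type) (psi : G -> K) : Prop :=
  forall p : seq G, is_path p -> ~ repetitively_coloured psi p.

Definition nonrepetitively_colourable (G : sgraph) (k : nat) : Prop :=
  exists psi : G -> 'I_k, nonrepetitive psi.

(* [P] is indexed by unordered pairs, so that each edge of [H] gets one path;
   its values outside [edges H] are irrelevant. *)
Definition contains_immersion (G H : sgraph) : Prop :=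
  exists (f : H -> G) (P : {set H} -> seq G),
    [/\ injective f,
        forall v w : H, adj v w -> path_between (f v) (f w) (P [set v; w]) &
        {in edges H &, forall A B, A != B ->
           [disjoint path_edges (P A) & path_edges (P B)]}].

(* Main.v *)
(** Let [k = t^2]. Uncrossing minimum cuts gives a laminar family [L] of vertex
    sets, each leaving fewer than [k] edges, such that two vertices not separated
    by [L] are [k]-edge-connected. If [t] vertices are pairwise [k]-edge-connected,
    a flow from one of them sending [t] units to each of them yields an immersion
    of every graph on [t] vertices; so every bag of [L] has fewer than [t] vertices.

    Adding a clique on the boundary of each member of [L], and grouping the vertices
    according to the least member of [L] containing their closed neighbourhood, we
    obtain blocks whose earlier neighbours form a clique of size at most [k], and
    which have degree at most [2k] apart from fewer than [t] vertices. Blocks are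
    coloured by Rosenfeld's counting argument. The adhesion [k] is then removed one
    unit at a time: layer the blocks by distance, colour each layer by induction,
    and add a colour of the layer number such that every repetitively coloured walk
    visits the same layers in both halves; the vertices of a repetitive path in its
    first layer would form a repetitive path of that layer. In total
    [t^O(1) * 72^k = 4^O(t^2)] colours are used. *)

Require Import Defs.
From mathcomp Require Import all_boot all_order all_algebra.
From mathcomp Require Import boolp zify ring.

Set Implicit Arguments.
Unset Strict Implicit.
Unset Printing Implicit Defensive.

(** * Nonrepetitive colourings *)

Definition nonrep_on (V : eqType) (K : Type) (e : rel V) (S : {pred V})
    (psi : V -> K) : Prop :=
  forall q r : seq V, q != [::] -> uniq (q ++ r) -> sorted e (q ++ r) ->
    {subset q ++ r <= S} -> map psi q <> map psi r.

Definition nonrep_colourable (V : eqType) (e : rel V) (S : {pred V}) (c : nat) : Prop :=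
  exists psi : V -> 'I_c, nonrep_on e S psi.

Lemma eq_map_factor (T : eqType) (K K' : Type) (f : T -> K) (g : T -> K') (q r : seq T) :
  {in q & r, forall u v, f u = f v -> g u = g v} ->
  map f q = map f r -> map g q = map g r.
Proof.
elim: q r => [|u q IH] [|v r] //= fg [fuv fqr].
rewrite (fg u v) ?mem_head // (IH r) // => x y xq yr.
by apply: fg; rewrite inE ?xq ?yr orbT.
Qed.

Lemma nonrep_on_sub (V : eqType) (K : Type) (e e' : rel V) (S S' : {pred V})
    (psi : V -> K) :
  {in S &, subrel e e'} -> {subset S <= S'} ->
  nonrep_on e' S' psi -> nonrep_on e S psi.
Proof.
move=> ee' SS' nr q r q_neq0 uniq_qr walk_qr qrS; apply: nr => //.
  by apply: (sub_in_sorted ee' _ walk_qr); apply/allP.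
by move=> x /qrS/SS'.
Qed.

Lemma nonrep_on_factor (V : eqType) (K K' : Type) (e : rel V) (S : {pred V})
    (psi : V -> K) (psi' : V -> K') :
  {in S &, forall u v, psi' u = psi' v -> psi u = psi v} ->
  nonrep_on e S psi -> nonrep_on e S psi'.
Proof.
move=> psiE nr q r q_neq0 uniq_qr walk_qr qrS eqr; apply: (nr q r) => //.
apply: eq_map_factor eqr => u v uq vr.
by apply: psiE; apply: qrS; rewrite mem_cat ?uq ?vr ?orbT.
Qed.

Lemma nonrep_colourable_card (V : eqType) (K : finType) (e : rel V) (S : {pred V})
    (psi : V -> K) (c : nat) :
  #|K| <= c -> nonrep_on e S psi -> nonrep_colourable e S c.
Proof.
move=> Kc nr; exists (fun v => widen_ord Kc (enum_rank (psi v))).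
by apply: nonrep_on_factor nr => u v _ _ [] /val_inj/enum_rank_inj.
Qed.

Lemma nonrep_colourable_sgraph (G : sgraph) (c : nat) :
  nonrep_colourable (@adj G) predT c -> nonrepetitively_colourable G c.
Proof.
move=> [psi nr]; exists psi => p /and3P[pn up sp] [s szp rep].
apply: (nr (take s p) (drop s p)); rewrite ?cat_take_drop //.
  by case: p s szp pn {up sp rep} => [//|x p] [|s] //=; lia.
have szt : size (take s p) = s by rewrite size_takel // szp; lia.
have szd : size (drop s p) = s by rewrite size_drop szp; lia.
have x0 : G by case: (p) pn.
apply: (@eq_from_nth _ (psi x0)); rewrite !size_map ?szt ?szd // => i si.
by rewrite !(nth_map x0) ?szt ?szd // nth_take // nth_drop rep.
Qed.

Lemma nonrep_colourable_exceptions (V : finType) (e : rel V) (S : {pred V})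
    (B : {set V}) (c : nat) :
  nonrep_colourable e [predD S & B] c -> nonrep_colourable e S (#|B| + c).
Proof.
move=> [psi nr].
pose col v : {x | x \in B} + 'I_c := if insub v is Some b then inl b else inr (psi v).
have col_inj v w : v \in B -> col v = col w -> v = w.
  by move=> vB; rewrite /col insubT; case: insubP => // b _ <- [<-].
have colN v : v \notin B -> col v = inr (psi v) by move=> vB; rewrite /col insubN.
apply: (nonrep_colourable_card (psi := col)); first by rewrite card_sum card_sig card_ord.
move=> q r q_neq0 uniq_qr walk_qr qrS E.
have half_notin (s s' : seq V) :
    uniq (s ++ s') -> map col s = map col s' -> {in s, forall v, v \notin B}.
  move=> uniq_ss' Es v vs; apply/negP => vB.
  have /mapP[w ws' /(col_inj _ _ vB) vw] : col v \in map col s' by rewrite -Es map_f.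
  by move: uniq_ss'; rewrite cat_uniq => /and3P[_ /hasPn/(_ w ws')/negP[]]; rewrite -vw.
have notin v : v \in q ++ r -> v \notin B.
  rewrite mem_cat => /orP[]; first exact: half_notin uniq_qr E v.
  by apply: half_notin (esym E) v; rewrite uniq_catC.
apply: (nr q r) => //; first by move=> v vqr; rewrite !inE notin // qrS.
apply: eq_map_factor E => u v uq vr.
by rewrite !colN ?notin ?mem_cat ?uq ?vr ?orbT // => -[].
Qed.

(** * Graphs of bounded degree *)

Section Walks.
Variables (V : finType) (e : rel V) (D : nat).
Hypothesis e_sym : symmetric e.
Hypothesis degD : forall v, #|[set w | e v w]| <= D.

Fixpoint walks (v : V) (n : nat) : seq (seq V) :=
  if n is n'.+1 then
    flatten [seq [seq w :: p | p <- walks w n'] | w <- enum [set w | e v w]]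
  else [:: [::]].

Lemma mem_walks v p : path e v p -> p \in walks v (size p).
Proof.
elim: p v => [|w p IH] v //= /andP[evw pp]; apply/flatten_mapP.
exists w; first by rewrite mem_enum inE.
by apply/mapP; exists p => //; apply: IH.
Qed.

Lemma size_walks v n : size (walks v n) <= D ^ n.
Proof.
elim: n v => [|n IH] v //=; rewrite size_flatten /shape -map_comp sumnE big_map.
apply: (@leq_trans (\sum_(w <- enum [set w | e v w]) D ^ n)).
  by apply: leq_sum => w _ /=; rewrite size_map.
rewrite big_const_seq count_predT -cardE iter_addn_0 expnS mulnC.
by rewrite leq_mul2r degD orbT.
Qed.

Definition walks_through v s :=
  flatten [seq [seq rev a ++ v :: b | a <- walks v i, b <- walks v (s - i)]
          | i <- iota 0 s.+1].

Lemma mem_walks_through v p s :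
  v \in p -> sorted e p -> size p = s.+1 -> p \in walks_through v s.
Proof.
move=> vp + sp; case/splitPr: p / vp sp => a b.
rewrite size_cat /= addnS => sab walk_p.
have {}sab : size a + size b = s by case: sab.
apply/flatten_mapP; exists (size a); first by rewrite mem_iota; lia.
apply/allpairsP; exists (rev a, b); split => //=; last by rewrite revK.
- rewrite -size_rev; apply: mem_walks.
  have := cat_sorted2 (s := rcons a v) (s' := b).
  rewrite cat_rcons => /(_ _ walk_p) [].
  by rewrite -rev_sorted rev_rcons /= (eq_path (e' := e)).
- have -> : s - size a = size b by lia.
  by apply: mem_walks; have /cat_sorted2[] := walk_p.
Qed.

Lemma size_walks_through v s : size (walks_through v s) <= s.+1 * D ^ s.
Proof.
rewrite size_flatten /shape -map_comp sumnE big_map.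
apply: (@leq_trans (\sum_(i <- iota 0 s.+1) D ^ s)).
  rewrite big_seq [leqRHS]big_seq; apply: leq_sum => i; rewrite mem_iota => i_le /=.
  rewrite size_allpairs.
  have -> : D ^ s = D ^ i * D ^ (s - i) by rewrite -expnD; congr (_ ^ _); lia.
  by apply: leq_mul; apply: size_walks.
by rewrite big_const_seq count_predT size_iota iter_addn_0 mulnC.
Qed.

Definition paths_through (S : {set V}) v s : {set s.-tuple V} :=
  [set p : s.-tuple V | [&& uniq p, sorted e p, v \in p & all [in S] p]].

Lemma card_paths_through S v s : #|paths_through S v s.+1| <= s.+1 * D ^ s.
Proof.
apply: leq_trans (size_walks_through v s); rewrite cardE -(size_map val).
apply: uniq_leq_size => [|_ /mapP[p + ->]].
  by rewrite (map_inj_uniq val_inj) enum_uniq.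
rewrite mem_enum inE => /and4P[_ walk_p vp _].
by apply: mem_walks_through => //; rewrite size_tuple.
Qed.
End Walks.

Lemma leq_card_bigcup (T : finType) (I : Type) (r : seq I) (P : pred I) (F : I -> {set T}) :
  #|\bigcup_(i <- r | P i) F i| <= \sum_(i <- r | P i) #|F i|.
Proof.
elim/big_rec2: _ => [|i n A _ An]; first by rewrite cards0.
by apply: leq_trans (leq_card_setU _ _) _; rewrite leq_add2l.
Qed.

Lemma geometric_sum_bound (K n : nat) (x : nat -> nat) :
  (forall s, x s * 2 ^ s <= K) -> \sum_(s < n) x s <= 2 * K.
Proof.
move=> xK.
have partial_sum : (\sum_(s < n) x s) * 2 ^ n + 2 * K <= 2 * K * 2 ^ n.
  elim: n => [|n IH]; first by rewrite big_ord0 mul0n muln1.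
  rewrite big_ord_recr /= expnS; have := xK n; move: IH.
  by move: (2 ^ n) (bigop _ _ _) (x n) => P S y; lia.
have : 0 < 2 ^ n by rewrite expn_gt0.
by move: partial_sum; move: (2 ^ n) (bigop _ _ _) => P S; nia.
Qed.

Section BoundedDegree.
Variables (V : finType) (e : rel V) (D c : nat).
Hypothesis e_sym : symmetric e.
Hypothesis D_gt0 : 0 < D.
Hypothesis degD : forall v, #|[set w | e v w]| <= D.
Hypothesis c_ge : 4 * D ^ 2 + 4 * D <= c.+1.
Implicit Types (S T W : {set V}) (v : V) (f : {ffun V -> 'I_c.+1}).

Definition colourings T S : {set {ffun V -> 'I_c.+1}} :=
  [set f : {ffun V -> 'I_c.+1} |
    `[< nonrep_on e [in T] f >] && (ord0.-support f \subset S)].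

Local Notation nb_col S := #|colourings S S|.

Lemma colouringsP T S f :
  reflect (nonrep_on e [in T] f /\ forall x, x \notin S -> f x = ord0)
          (f \in colourings T S).
Proof.
by rewrite inE; apply: (iffP andP) => -[/asboolP nr /supportP sf]; split.
Qed.

Lemma card_colourings_setD1 S v :
  v \in S -> c.+1 * nb_col (S :\ v) <= #|colourings (S :\ v) S|.
Proof.
move=> vS.
pose extend (af : 'I_c.+1 * {ffun V -> 'I_c.+1}) : {ffun V -> 'I_c.+1} :=
  [ffun x => if x == v then af.1 else af.2 x].
have -> : c.+1 * nb_col (S :\ v) = #|setX [set: 'I_c.+1] (colourings (S :\ v) (S :\ v))|.
  by rewrite cardsX cardsT card_ord.
rewrite -(card_in_imset (f := extend)).
  apply/subset_leq_card/subsetP => _ /imsetP[[a f] + ->].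
  rewrite in_setX => /andP[_ /colouringsP[nrf sf]]; apply/colouringsP; split.
    apply: nonrep_on_factor nrf => x y; rewrite !inE => /andP[/negPf xv _] /andP[/negPf yv _].
    by rewrite !ffunE xv yv.
  move=> x xS; rewrite ffunE; case: eqP => [E|_]; first by rewrite E vS in xS.
  by apply: sf; rewrite !inE (negPf xS) andbF.
move=> [a f] [b g]; rewrite !in_setX.
move=> /andP[_ /colouringsP[_ sf]] /andP[_ /colouringsP[_ sg]] /ffunP E.
congr pair; first by have := E v; rewrite !ffunE eqxx.
apply/ffunP => x; have := E x; rewrite !ffunE; case: eqP => // -> _.
by rewrite sf ?sg // !inE eqxx.
Qed.

Definition repeating S v (q r : seq V) : {set {ffun V -> 'I_c.+1}} :=
  [set f in colourings (S :\ v) S | map f q == map f r].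

Lemma repeatingC S v q r : repeating S v q r = repeating S v r q.
Proof. by apply/setP => f; rewrite !inE [map f q == _]eq_sym. Qed.

(* Erasing the colours of [q] loses nothing, since they can be read off from [r]. *)
Lemma card_repeating_erase S v q r :
  uniq (q ++ r) -> v \in q -> #|repeating S v q r| <= nb_col (S :\: [set x in q]).
Proof.
move=> uniq_qr vq.
pose erase f : {ffun V -> 'I_c.+1} := [ffun x => if x \in q then ord0 else f x].
rewrite -(card_in_imset (f := erase)).
  apply/subset_leq_card/subsetP => _ /imsetP[f + ->].
  rewrite inE => /andP[/colouringsP[nrf sf] _]; apply/colouringsP; split.
    apply: (@nonrep_on_factor _ _ _ _ _ f).
      by move=> x y; rewrite !inE !ffunE => /andP[/negPf-> _] /andP[/negPf-> _].
    apply: nonrep_on_sub nrf => // x; rewrite !inE => /andP[xq ->].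
    by rewrite andbT; apply: contraNneq xq => ->.
  by move=> x; rewrite !inE negb_and negbK ffunE; case: (x \in q) => //= /sf.
move=> f g; rewrite !inE => /andP[_ /eqP fqr] /andP[_ /eqP gqr] /ffunP E.
have fg x : x \notin q -> f x = g x.
  by move=> xq; have := E x; rewrite !ffunE (negPf xq).
have fgr : map f r = map g r.
  apply/eq_in_map => y yr; apply: fg; apply/negP => yq.
  by move: uniq_qr; rewrite cat_uniq => /and3P[_ /hasPn/(_ _ yr)/negP].
have /eq_in_map fgq : map f q = map g q by rewrite fqr gqr fgr.
by apply/ffunP => x; have [/fgq|/fg] := boolP (x \in q).
Qed.

Definition growth_below n :=
  forall S v, #|S| < n -> v \in S -> 4 * D ^ 2 * nb_col (S :\ v) <= nb_col S.

Lemma card_colourings_setD S W : growth_below #|S|.+1 -> W \subset S ->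
  (4 * D ^ 2) ^ #|W| * nb_col (S :\: W) <= nb_col S.
Proof.
move=> growth; have [n] := ubnP #|W|; elim: n W => // n IH W.
have [->|[w wW]] := set_0Vmem W; first by rewrite cards0 setD0 mul1n.
rewrite ltnS (cardsD1 w) wW => Wn WS.
have wS := subsetP WS _ wW.
apply: leq_trans (IH (W :\ w) _ _); [|exact: Wn|exact: subset_trans (subD1set _ _) WS].
rewrite expnD expn1 mulnAC [leqRHS]mulnC leq_mul2r; apply/orP; right.
have -> : S :\: W = (S :\: (W :\ w)) :\ w.
  by apply/setP => x; rewrite !inE; case: eqVneq => //= ->; rewrite wW.
apply: growth; first by rewrite ltnS; apply/subset_leq_card/subsetDl.
by rewrite !inE eqxx.
Qed.

Lemma card_repeating S v q r s :
  growth_below #|S| -> v \in S -> uniq (q ++ r) -> {subset q <= S} -> v \in q ->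
  size q = s.+1 -> (4 * D ^ 2) ^ s * #|repeating S v q r| <= nb_col (S :\ v).
Proof.
move=> growth vS uniq_qr qS vq sq.
have cq : #|[set x in q] :\ v| = s.
  have /card_uniqP uniq_q : uniq q by move: uniq_qr; rewrite cat_uniq => /andP[].
  have : #|[set x in q]| = s.+1 by rewrite cardsE uniq_q.
  by rewrite (cardsD1 v) inE vq => -[].
apply: leq_trans (leq_mul (leqnn _) (card_repeating_erase S uniq_qr vq)) _.
have -> : S :\: [set x in q] = (S :\ v) :\: ([set x in q] :\ v).
  by apply/setP => x; rewrite !inE; case: eqVneq => //= ->; rewrite vq.
rewrite -{1}cq; apply: card_colourings_setD.
  by rewrite (cardsD1 v) vS add1n in growth.
by apply: setSD; apply/subsetP => x; rewrite inE => /qS.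
Qed.

Lemma card_repeating_halves S v s (p : s.*2.+2.-tuple V) :
  growth_below #|S| -> v \in S -> p \in paths_through e S v s.*2.+2 ->
  (4 * D ^ 2) ^ s * #|repeating S v (take s.+1 p) (drop s.+1 p)| <= nb_col (S :\ v).
Proof.
move=> growth vS; rewrite inE => /and4P[uniq_p _ vp /allP pS].
have sp := size_tuple p; have pE := cat_take_drop s.+1 p.
have := vp; rewrite -[v \in p]/(v \in tval p) -{1}pE mem_cat => /orP[vt|vd].
  apply: card_repeating; rewrite ?pE //; last by rewrite size_takel // sp; lia.
  by move=> x /mem_take/pS.
rewrite repeatingC; apply: card_repeating; rewrite 1?uniq_catC ?pE //.
  by move=> x /mem_drop/pS.
by rewrite size_drop sp; lia.
Qed.

Lemma card_repeating_through S v s :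
  growth_below #|S| -> v \in S ->
  #|\bigcup_(p in paths_through e S v s.*2.+2) repeating S v (take s.+1 p) (drop s.+1 p)|
    * 2 ^ s <= 2 * D * nb_col (S :\ v).
Proof.
move=> growth vS; set x := #|_|; set M := nb_col _.
have D2s : 0 < D ^ s.*2 by rewrite expn_gt0 D_gt0.
have P2 : 0 < 2 ^ s by rewrite expn_gt0.
have x_le : (4 * D ^ 2) ^ s * x <= s.*2.+2 * D ^ s.*2.+1 * M.
  apply: leq_trans (leq_mul (leqnn _) (leq_card_bigcup _ _ _)) _; rewrite big_distrr /=.
  apply: (@leq_trans (\sum_(p in paths_through e S v s.*2.+2) M)).
    by apply: leq_sum => p; apply: card_repeating_halves.
  by rewrite sum_nat_const leq_mul2r card_paths_through ?orbT.
rewrite -(leq_pmul2l (m := 2 ^ s * D ^ s.*2)); last by rewrite muln_gt0 P2.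
have -> : 2 ^ s * D ^ s.*2 * (x * 2 ^ s) = (4 * D ^ 2) ^ s * x.
  by rewrite expnMn -expnM mul2n (expnMn 2 2); ring.
apply: leq_trans x_le _; rewrite (_ : s.*2.+2 = 2 * s.+1) ?expnS; last by lia.
have -> : 2 ^ s * D ^ s.*2 * (2 * D * M) = 2 * 2 ^ s * (D * D ^ s.*2) * M by ring.
by rewrite !leq_mul2r leq_mul2l ltn_expl ?orbT.
Qed.

Lemma repeating_cover S v :
  colourings (S :\ v) S :\: colourings S S \subset
  \bigcup_(s < #|V|) \bigcup_(p in paths_through e S v s.*2.+2)
     repeating S v (take s.+1 p) (drop s.+1 p).
Proof.
apply/subsetP => f; rewrite in_setD => /andP[fS fSv].
have [nrf sf] := colouringsP _ _ _ fSv.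
apply: contrapT => /negP f_cover; case/negP: fS; apply/colouringsP; split=> //.
move=> q r q_neq0 uniq_qr walk_qr qrS fqr.
have sz : size r = size q by rewrite -(size_map f) -fqr size_map.
case vqr: (v \in q ++ r); last first.
  apply: (nrf q r) => // x xqr; rewrite !inE; apply/andP; split; last exact: qrS.
  by apply: contraFneq vqr => <-.
have q_gt0 : 0 < size q by rewrite lt0n size_eq0.
have qV : (size q).-1 < #|V|.
  have := max_card [in q ++ r]; move/card_uniqP: uniq_qr => ->.
  by rewrite size_cat sz prednK //; lia.
have szqr : size (q ++ r) == ((size q).-1).*2.+2 by rewrite size_cat sz; lia.
case/negP: f_cover; apply/bigcupP; exists (Ordinal qV) => //.
apply/bigcupP; exists (Tuple szqr); rewrite inE.
  by rewrite uniq_qr walk_qr vqr; apply/allP.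
by rewrite fSv prednK // take_size_cat // drop_size_cat // fqr eqxx.
Qed.

(* Rosenfeld's counting argument: by induction the repetitive extensions of
   colourings of [S :\ v] to [S] are outnumbered. *)
Lemma growth n : growth_below n.
Proof.
elim: n => // n IH S v Sn vS.
have growthS : growth_below #|S| by move=> S' u S'S; apply: IH; apply: leq_trans S'S _.
set M := nb_col (S :\ v).
have repeating_le : #|colourings (S :\ v) S :\: colourings S S| <= 2 * (2 * D * M).
  apply: leq_trans (subset_leq_card (repeating_cover S v)) _.
  apply: leq_trans (leq_card_bigcup _ _ _) _.
  exact: geometric_sum_bound (fun s => card_repeating_through s growthS vS).
have := card_colourings_setD1 vS; rewrite -/M -(cardsID (colourings S S)).
have := subset_leq_card (subsetIr (colourings (S :\ v) S) (colourings S S)).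
by move: repeating_le c_ge; nia.
Qed.

Lemma nonrep_on_exists : exists psi : V -> 'I_c.+1, nonrep_on e predT psi.
Proof.
have : 0 < nb_col setT.
  apply: (leq_trans _ (card_colourings_setD (@growth _) (subxx setT))).
  rewrite muln_gt0 expn_gt0 muln_gt0 expn_gt0 D_gt0 /=.
  apply/card_gt0P; exists [ffun => ord0]; apply/colouringsP; split=> [|x _].
    by case=> // x q r _ _ _ /(_ x); rewrite mem_head setDv inE => /(_ isT).
  by rewrite ffunE.
move=> /card_gt0P[f /colouringsP[nrf _]]; exists f.
by apply: nonrep_on_sub nrf => // x _; rewrite inE.
Qed.
End BoundedDegree.

Lemma bounded_degree_nonrep_colourable (V : finType) (e : rel V) (S : {pred V}) (D : nat) :
  symmetric e -> 0 < D -> {in S, forall v, #|[set w in S | e v w]| <= D} ->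
  nonrep_colourable e S (4 * D ^ 2 + 4 * D).
Proof.
move=> e_sym D_gt0 degD; pose eS := [rel u v | [&& u \in S, v \in S & e u v]].
have eS_sym : symmetric eS by move=> u v /=; rewrite e_sym andbCA.
have eS_deg v : #|[set w | eS v w]| <= D.
  have [vS|/negPf vS] := boolP (v \in S).
    apply: leq_trans (degD v vS); apply/subset_leq_card/subsetP => w.
    by rewrite !inE => /and3P[_ -> ->].
  by rewrite (_ : [set w | eS v w] = set0) ?cards0 //; apply/setP => w; rewrite !inE /= vS.
have cE : (4 * D ^ 2 + 4 * D).-1.+1 = 4 * D ^ 2 + 4 * D by lia.
have [|psi nr] := nonrep_on_exists eS_sym D_gt0 eS_deg (c := (4 * D ^ 2 + 4 * D).-1).
  by rewrite cE.
apply: (nonrep_colourable_card (psi := psi)); first by rewrite card_ord cE.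
by apply: nonrep_on_sub nr => // u v uS vS euv; apply/and3P.
Qed.

(** * Walks on the integers *)

Lemma square_free_word (n : nat) : exists w : nat -> 'I_24,
  forall a d, 0 < d -> a + d.*2 <= n ->
    ~ (forall j, j < d -> w (a + j) = w (a + d + j)).
Proof.
pose e := [rel i j : 'I_n.+1 | (i.+1 == j :> nat) || (j.+1 == i :> nat)].
have e_sym : symmetric e by move=> i j; rewrite /= orbC.
have [//|i _|w nrw] := @bounded_degree_nonrep_colourable _ e predT 2 e_sym.
  apply: (@leq_trans #|[set inord i.+1; inord i.-1] : {set 'I_n.+1}|); last first.
    by rewrite cards2; case: (_ != _).
  apply/subset_leq_card/subsetP => j; rewrite !inE => /orP[/eqP ij|/eqP ji].
    by rewrite ij inord_val eqxx.
  by rewrite -ji inord_val eqxx orbT.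
exists (fun i => w (inord i)) => a d d_gt0 adn square.
pose s b m : seq 'I_n.+1 := [seq inord i | i <- iota b m].
have catE : s a d ++ s (a + d) d = s a d.*2 by rewrite -map_cat -iotaD addnn.
have sortedE m b : b + m <= n.+1 -> sorted e (s b m).
  elim: m b => [|[|m] IH] b bm //=; have := IH b.+1; rewrite /= => ->; last by lia.
  by rewrite !inordK ?eqxx //; lia.
apply: (nrw (s a d) (s (a + d) d)); rewrite ?catE //.
- by case: d d_gt0 {adn square catE}.
- rewrite map_inj_in_uniq ?iota_uniq // => i j; rewrite !mem_iota => ia ja.
  by move/(congr1 val); rewrite /= !inordK //; lia.
- by apply: sortedE; lia.
apply: (@eq_from_nth _ (w ord0)); rewrite !size_map !size_iota // => i id.
by rewrite -!map_comp !(nth_map 0) ?size_iota // !nth_iota //= square.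
Qed.

Definition lazy_step : rel nat := [rel x y | (x <= y.+1) && (y <= x.+1)].

Lemma lazy_walk_ivt a p v : path lazy_step a p -> a <= v <= last a p -> v \in a :: p.
Proof.
elim: p a => [|x p IH] a /=; first by rewrite inE => _; lia.
move=> /andP[/andP[_ xa] xp] /andP[av vl]; rewrite in_cons.
by have [//|va /=] := eqVneq v a; apply: IH => //; lia.
Qed.

Lemma lazy_walk_translate a b p q :
  path lazy_step a p -> path lazy_step b q -> a = b %[mod 3] -> a <= b ->
  map (modn^~ 3) p = map (modn^~ 3) q -> map (addn (b - a)) p = q.
Proof.
elim: p q a b => [|x p IH] [|y q] a b //= /andP[ax xp] /andP[b_y yq] ab3 ab [xy3 pq3].
have xyab : [/\ x <= y, y - x = b - a & b - a + x = y].
  by move: ax b_y; rewrite /lazy_step /=; split; lia.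
by case: xyab => xy <- E; rewrite -(IH q x y) // E.
Qed.

Lemma lazy_walk_square (K : Type) (w : nat -> K) (q : seq nat) d n :
  0 < d -> q != [::] -> sorted lazy_step (q ++ map (addn d) q) ->
  all (geq n) (map (addn d) q) -> map w q = map w (map (addn d) q) ->
  exists2 a, a + d.*2 <= n.+1 & forall j, j < d -> w (a + j) = w (a + d + j).
Proof.
case: q => // a q d_gt0 _ + bound wE; rewrite /= cat_path /= => /and3P[aq lq _].
have mem_q j : j < d -> a + j \in a :: q.
  move=> jd; have : a + j \in a :: rcons q (d + a).
    by apply: lazy_walk_ivt; rewrite ?rcons_path ?aq ?last_rcons //; lia.
  by rewrite -rcons_cons mem_rcons inE => /predU1P[|//]; lia.
exists a => [|j jd].
  have /(map_f (addn d))/(allP bound) /= : a + d.-1 \in a :: q by apply: mem_q; rewrite prednK.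
  by lia.
have /eq_in_map wE' : map w (a :: q) = map (w \o addn d) (a :: q) by rewrite map_comp.
by rewrite wE' ?mem_q //=; congr w; lia.
Qed.

(* The residue mod 3 in the colour reveals every step of the walk, so the two
   halves of a repetition are translates of each other; a nonzero translation
   would produce a square in the second component. *)
Lemma lazy_walk_colouring (n : nat) : exists phi : nat -> 'I_3 * 'I_24,
  forall q r : seq nat, sorted lazy_step (q ++ r) -> all (geq n) (q ++ r) ->
    map phi q = map phi r -> q = r.
Proof.
have [w w_sqfree] := square_free_word n.+1.
exists (fun i => (inZp i, w i)) => q r walk bound E.
have Ew : map w q = map w r by apply: eq_map_factor E => i j _ _ [].
have E3 : map (modn^~ 3) q = map (modn^~ 3) r.
  by apply: eq_map_factor E => i j _ _ [].
have no_square (s : seq nat) d : 0 < d -> s != [::] ->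
    sorted lazy_step (s ++ map (addn d) s) -> all (geq n) (map (addn d) s) ->
    map w s = map w (map (addn d) s) -> False.
  by move=> d0 s0 ws bs ds; have [a /w_sqfree] := lazy_walk_square d0 s0 ws bs ds; apply.
case: q r => [|a q] [|b r] // in walk bound E Ew E3 *; case: E3 => ab3 qr3.
have /andP[boundq boundr] : all (geq n) (a :: q) && all (geq n) (b :: r) by rewrite -all_cat.
have [aq br] : path lazy_step a q /\ path lazy_step b r.
  by have [/= + +] := cat_sorted2 walk.
have [ab|/ltnW ba] := leqP a b.
  have rE : map (addn (b - a)) (a :: q) = b :: r.
    by rewrite /= (lazy_walk_translate aq br) ?subnK.
  have [d0|d_gt0] := posnP (b - a); first by rewrite -rE d0 (eq_map add0n) map_id.
  by rewrite -rE in walk boundr Ew; case: (no_square _ _ d_gt0 _ walk boundr Ew).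
have qE : map (addn (a - b)) (b :: r) = a :: q.
  by rewrite /= (lazy_walk_translate br aq) ?subnK.
have [d0|d_gt0] := posnP (a - b); first by rewrite -qE d0 (eq_map add0n) map_id.
case: (no_square (rev (b :: r)) _ d_gt0); rewrite ?map_rev ?qE ?all_rev ?Ew //.
- by rewrite -size_eq0 size_rev.
- by rewrite -rev_cat rev_sorted; apply: sub_sorted walk => x y; rewrite /lazy_step /= andbC.
Qed.

(** * Shadow-complete layerings *)

Section ShadowComplete.
Variables (V : finType) (e : rel V) (d : V -> nat).

Definition layering := forall u v, e u v -> lazy_step (d u) (d v).

Definition shadow_complete := forall u s w, s != [::] -> path e u (rcons s w) ->
  all (fun x => d u < d x) s -> d w = d u -> u = w \/ e u w.

Hypothesis layering_d : layering.
Hypothesis shadow_complete_d : shadow_complete.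

Lemma path_filter_layer s t u :
  path e u t -> all (fun x => d u < d x) t ->
  path e (last u t) s -> all (fun x => d u <= d x) s -> u \notin s -> uniq s ->
  path e u [seq x <- s | d x == d u].
Proof.
elim: s t u => [//|x s IH] t u ut deep_t /= /andP[tx xs] /andP[ux deep_s].
rewrite inE negb_or => /andP[u_neq_x us] /andP[x_notin_s uniq_s].
case: ifPn => [/eqP dx|dx]; last first.
  apply: (IH (rcons t x)); rewrite ?last_rcons ?rcons_path ?ut //.
  by rewrite all_rcons deep_t andbT; lia.
rewrite /= -dx; apply/andP; split; last by apply: (IH [::]); rewrite //= dx.
have [t0|t_neq0] := eqVneq t [::]; first by move: tx; rewrite t0.
have [|xu|//] := shadow_complete_d t_neq0 _ deep_t dx; first by rewrite rcons_path ut.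
by rewrite xu eqxx in u_neq_x.
Qed.

Lemma sorted_filter_layer m s :
  sorted e s -> uniq s -> all (fun x => m <= d x) s ->
  sorted e [seq x <- s | d x == m].
Proof.
elim: s => [//|x s IH] /= xs /andP[x_notin_s uniq_s] /andP[mx deep_s].
case: ifPn => [/eqP dx|_]; last by apply: IH => //; apply: path_sorted xs.
by rewrite /= -dx; apply: (@path_filter_layer s [::]); rewrite //= dx.
Qed.

Lemma eq_map_filter_layer (K : Type) (psi : nat -> V -> K) m (q r : seq V) :
  map d q = map d r -> map (fun v => psi (d v) v) q = map (fun v => psi (d v) v) r ->
  map (psi m) [seq v <- q | d v == m] = map (psi m) [seq v <- r | d v == m].
Proof.
elim: q r => [|u q IH] [|v r] //= [duv dqr] [puv pqr]; rewrite -duv.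
case: eqP => [du|_] /=; last exact: IH.
by move: puv; rewrite -duv du => ->; rewrite (IH r).
Qed.

Lemma layers_nonrep_colourable c :
  (forall m : nat, nonrep_colourable e [pred v | d v == m] c) ->
  nonrep_colourable e predT (72 * c).
Proof.
move=> /choice[psi psi_nr].
have [phi phiP] := lazy_walk_colouring (\max_v d v).
apply: (@nonrep_colourable_card _ ('I_3 * 'I_24 * 'I_c)%type _ _
          (fun v => (phi (d v), psi (d v) v))); first by rewrite !card_prod !card_ord.
move=> q r q_neq0 uniq_qr walk _ E.
have Ed : map d q = map d r.
  apply: phiP; rewrite -?map_cat.
  - by rewrite sorted_map; apply: sub_sorted walk => x y; apply: layering_d.
  - by apply/allP => _ /mapP[v _ ->]; apply: leq_bigmax.
  by rewrite -!map_comp; apply: eq_map_factor E => u v _ _ [].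
have Epsi : map (fun v => psi (d v) v) q = map (fun v => psi (d v) v) r.
  by apply: eq_map_factor E => u v _ _ [].
have [x0 x0q] : exists x, x \in q by case: (q) q_neq0 => // x q' _; exists x; apply: mem_head.
have [x xq xmin] := arg_minnP d (x0q : (x0 \in [in q])).
have x_min v : v \in q ++ r -> d x <= d v.
  rewrite mem_cat => /orP[/xmin//|vr].
  by have /mapP[y /xmin yq ->] : d v \in map d q by rewrite Ed map_f.
apply: (psi_nr (d x) [seq v <- q | d v == d x] [seq v <- r | d v == d x]);
  rewrite -?filter_cat.
- by rewrite -has_filter; apply/hasP; exists x => /=.
- exact: filter_uniq.
- by apply: sorted_filter_layer => //; apply/allP.
- by move=> v; rewrite mem_filter => /andP[].
exact: eq_map_filter_layer.
Qed.
End ShadowComplete.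

(** * Clique blocks *)

Section Blocks.
Variables (V : finType) (h : V -> nat).

Definition backnbrs (e : rel V) (z : nat) : {set V} :=
  [set u | (h u < z) && [exists v, (h v == z) && e u v]].

Definition clique_blocks (e : rel V) (k : nat) : Prop :=
  forall z : nat, #|backnbrs e z| <= k /\ {in backnbrs e z &, forall u v, u != v -> e u v}.

Section Layering.
Variables (e : rel V) (k : nat).
Hypothesis e_sym : symmetric e.
Hypothesis e_blocks : clique_blocks e k.

Local Notation A := (backnbrs e).

Lemma mem_backnbrs u v : e u v -> h u < h v -> u \in A (h v).
Proof. by move=> euv huv; rewrite inE huv; apply/existsP; exists v; rewrite eqxx. Qed.

Lemma backnbrs_lt u z : u \in A z -> h u < z.
Proof. by rewrite inE => /andP[]. Qed.

Fixpoint reaches_root (n z : nat) : bool :=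
  if n is n'.+1 then [exists u in A z, reaches_root n' (h u)] else A z == set0.

Lemma reaches_root_exists z : exists n, reaches_root n z.
Proof.
have [n] := ubnP z; elim: n z => // n IH z zn.
have [A0|[u uA]] := set_0Vmem (A z); first by exists 0; rewrite /= A0.
have [|m um] := IH (h u); first by have := backnbrs_lt uA; lia.
by exists m.+1; apply/exists_inP; exists u.
Qed.

Definition block_depth z := ex_minn (reaches_root_exists z).

Local Notation depth v := (block_depth (h v)).

Lemma block_depthP z :
  reaches_root (block_depth z) z /\ forall n, reaches_root n z -> block_depth z <= n.
Proof. by rewrite /block_depth; case: ex_minnP. Qed.

Lemma block_depth_leS u z : u \in A z -> block_depth z <= (depth u).+1.
Proof.
move=> uA; have [_] := block_depthP z; apply.
by apply/exists_inP; exists u => //; have [] := block_depthP (h u).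
Qed.

Lemma block_depth_parent z :
  A z != set0 -> exists2 u, u \in A z & block_depth z = (depth u).+1.
Proof.
move=> A0; have [+ _] := block_depthP z.
case dz: (block_depth z) => [|n] /=; first by rewrite (negPf A0).
case/exists_inP=> u uA un; exists u => //; have := block_depth_leS uA.
by have [_ /(_ _ un)] := block_depthP (h u); lia.
Qed.

Lemma depth_step u v : u \in A (h v) -> depth u <= depth v <= (depth u).+1.
Proof.
have [n] := ubnP (h v); elim: n u v => // n IH u v vn uA; rewrite block_depth_leS // andbT.
have [|w wA ->] := @block_depth_parent (h v); first by apply/set0Pn; exists u.
have [->//|uw] := eqVneq u w.
have euw := (e_blocks (h v)).2 _ _ uA wA uw.
have hu := backnbrs_lt uA; have hw := backnbrs_lt wA.
have [lt|gt|->//] := ltngtP (h u) (h w).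
  by have := IH u w _ (mem_backnbrs euw lt); lia.
by rewrite e_sym in euw; have := IH w u _ (mem_backnbrs euw gt); lia.
Qed.

Definition block_bag z : {set V} := [set x | h x == z] :|: A z.
Lemma block_bagP z x : reflect (h x = z \/ x \in A z) (x \in block_bag z).
Proof. by rewrite in_setU [x \in [set _ | _]]inE; apply: (iffP predU1P). Qed.

Definition bag_adj x y := (x \in block_bag (h y)) || (y \in block_bag (h x)).

Lemma bag_adj_sym : symmetric bag_adj.
Proof. by move=> x y; rewrite /bag_adj orbC. Qed.

Lemma bag_adj_sub : subrel e bag_adj.
Proof.
move=> x y exy; apply/orP; have [lt|gt|hxy] := ltngtP (h x) (h y).
- by left; apply/block_bagP; right; apply: mem_backnbrs.
- by right; apply/block_bagP; right; apply: mem_backnbrs; rewrite // e_sym.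
by left; apply/block_bagP; left.
Qed.

Lemma bag_adj_lazy_step x y : bag_adj x y -> lazy_step (depth x) (depth y).
Proof.
by rewrite /lazy_step /= => /orP[]/block_bagP[->|/depth_step]; lia.
Qed.

Lemma block_bag_adj z : {in block_bag z &, forall x y, bag_adj x y}.
Proof.
move=> x y /block_bagP xz /block_bagP yz.
have [->|xy] := eqVneq x y; first by apply/orP; left; apply/block_bagP; left.
case: xz yz => [<-|xA] [yz|yA].
- by apply/orP; left; apply/block_bagP; left.
- by apply/orP; right; apply/block_bagP; right.
- by apply/orP; left; apply/block_bagP; right; rewrite yz.
exact: bag_adj_sub ((e_blocks z).2 _ _ xA yA xy).
Qed.

Lemma bag_adj_shallow x y : bag_adj x y -> depth x < depth y -> x \in A (h y).
Proof.
by case/orP=> /block_bagP[|]; [move=> ->; lia|by []|move=> ->; lia|move/depth_step; lia].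
Qed.

Lemma path_bag_adj_delete u s1 x s2 w :
  last u s1 \in block_bag (h x) -> head w s2 \in block_bag (h x) ->
  path bag_adj u (rcons (s1 ++ x :: s2) w) -> path bag_adj u (rcons (s1 ++ s2) w).
Proof.
move=> bag1 bag2; have adj12 := block_bag_adj bag1 bag2.
by case: s2 bag2 adj12 => [|y s2] /= _ adj12;
  rewrite !rcons_cat !cat_path /= adj12 => /and3P[-> _ /andP[]].
Qed.

(* Deleting a vertex of the last block from the excursion keeps it a walk. *)
Lemma excursion_adj u s w :
  s != [::] -> path bag_adj u (rcons s w) ->
  all (fun x => depth u < depth x) s -> depth w = depth u -> u = w \/ e u w.
Proof.
have [n] := ubnP (size s); elim: n s => // n IH s s_lt s_neq0 walk deep dw.
have [x xs x_max] : exists2 x, x \in s & forall y, y \in s -> h y <= h x.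
  case: s s_neq0 {s_lt walk deep IH} => // a s _.
  by have [x xs x_max] := arg_maxnP h (mem_head a s : a \in [in a :: s]); exists x.
have bag_x y : (y \in s) || (depth y == depth u) -> bag_adj y x -> y \in block_bag (h x).
  case/orP=> [ys|/eqP dy] yx; last first.
    by apply/block_bagP; right; apply: (bag_adj_shallow yx); rewrite dy (allP deep).
  case/orP: yx => // /block_bagP[xy|/backnbrs_lt]; first by apply/block_bagP; left.
  by have := x_max y ys; lia.
case/splitPr: s / xs s_lt s_neq0 walk deep bag_x {x_max} => s1 s2 s_lt _ walk deep bag_x.
have [bag1 bag2] : last u s1 \in block_bag (h x) /\ head w s2 \in block_bag (h x).
  move: walk; rewrite rcons_cat cat_path /= => /and3P[_ s1x xs2]; split.
    apply: bag_x s1x; rewrite mem_cat; have := mem_last u s1; rewrite inE.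
    by case/predU1P=> [->|->]; rewrite ?eqxx ?orbT.
  case: s2 xs2 {s_lt deep} bag_x => [|y s2] /= /andP[xy _] bag_x.
    by apply: bag_x; rewrite ?dw ?eqxx ?orbT // bag_adj_sym.
  by apply: bag_x; rewrite ?mem_cat ?inE ?eqxx ?orbT // bag_adj_sym.
have [s12|s12] := eqVneq (s1 ++ s2) [::]; last first.
  apply: IH s12 (path_bag_adj_delete bag1 bag2 walk) _ dw.
    by move: s_lt; rewrite !size_cat /=; lia.
  by move: deep; rewrite !all_cat /= => /and3P[-> _ ->].
case: s1 s2 s12 walk deep {s_lt bag_x bag1 bag2} => [|//] [|//] _ /=.
move=> /and3P[ux xw _] /andP[dx _].
have [->|uw] := eqVneq u w; [by left|right].
apply: (e_blocks (h x)).2 uw; first exact: bag_adj_shallow.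
by apply: bag_adj_shallow; [rewrite bag_adj_sym|rewrite dw].
Qed.

Lemma block_depth_layering : layering e (fun v => depth v).
Proof. by move=> u v /bag_adj_sub/bag_adj_lazy_step. Qed.

Lemma block_depth_shadow_complete : shadow_complete e (fun v => depth v).
Proof. by move=> u s w s_neq0 /(sub_path bag_adj_sub); apply: excursion_adj. Qed.

Definition layer_adj (m : nat) : rel V := [rel u v | [&& e u v, depth u == m & depth v == m]].

Lemma layer_adj_sym m : symmetric (layer_adj m).
Proof. by move=> u v; rewrite /layer_adj /= e_sym [(_ == m) && _]andbC. Qed.

(* In its layer, a block misses the earlier neighbour, one layer up, that determines
   its depth. *)
Lemma clique_blocks_layer m : clique_blocks (layer_adj m) k.-1.
Proof.
have sub z : backnbrs (layer_adj m) z \subset [set u in A z | depth u == m].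
  apply/subsetP => u; rewrite !inE => /andP[-> /existsP[v /and4P[hv euv -> _]]].
  by rewrite andbT; apply/existsP; exists v; rewrite hv.
move=> z; split=> [|u v /(subsetP (sub z)) + /(subsetP (sub z))]; last first.
  rewrite !inE => /andP[uA du] /andP[vA dv] uv.
  by rewrite /layer_adj /= du dv ((e_blocks z).2 _ _ _ _ uv) // inE.
have [->|[w wz]] := set_0Vmem (backnbrs (layer_adj m) z); first by rewrite cards0.
have dz : block_depth z = m.
  by move: wz; rewrite inE => /andP[_ /existsP[v /and4P[/eqP<- _ _ /eqP]]].
have [|p pA dp] := @block_depth_parent z.
  by apply/set0Pn; exists w; have := subsetP (sub z) _ wz; rewrite inE => /andP[].
suff : #|backnbrs (layer_adj m) z| < #|A z| by have := (e_blocks z).1; lia.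
apply: proper_card; apply/properP; split.
  by apply: subset_trans (sub z) _; apply/subsetP => u; rewrite inE => /andP[].
by exists p => //; apply/negP => /(subsetP (sub z)); rewrite inE pA /=; lia.
Qed.
End Layering.

Lemma clique_blocks_nonrep_colourable (e : rel V) (k c : nat) :
  symmetric e -> clique_blocks e k ->
  (forall z : nat, nonrep_colourable e [pred v | h v == z] c) ->
  nonrep_colourable e predT (72 ^ k.+1 * c).
Proof.
elim: k e => [|k IH] e e_sym e_blocks colour_block.
  have same_block u v : e u v -> h u = h v.
    have A0 z : backnbrs e z = set0 by apply: cards0_eq; have := (e_blocks z).1; lia.
    move=> euv; have [lt|gt|//] := ltngtP (h u) (h v).
      by have := mem_backnbrs euv lt; rewrite A0 inE.
    by rewrite e_sym in euv; have := mem_backnbrs euv gt; rewrite A0 inE.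
  apply: (@layers_nonrep_colourable _ _ h) => // [u v /same_block ->|].
    by rewrite /lazy_step /= leqnSn.
  by move=> u [|x s] //= w _ /andP[/same_block -> _] /andP[]; rewrite ltnn.
rewrite expnS -mulnA; apply: (layers_nonrep_colourable (block_depth_layering e_sym e_blocks)).
  exact: block_depth_shadow_complete.
move=> m; have [|z|psi nr] := IH (layer_adj e m) (layer_adj_sym e_sym m).
- exact: (clique_blocks_layer e_blocks m).
- have [psi nr] := colour_block z; exists psi.
  by apply: nonrep_on_sub nr => // u v _ _ /andP[].
exists psi; apply: nonrep_on_sub nr => // u v; rewrite !inE => du dv euv.
by rewrite /layer_adj /= euv du.
Qed.
End Blocks.

(** * Minimum cuts *)

Section Cuts.
Variables (V : finType) (e : rel V).
Hypothesis e_sym : symmetric e.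
Implicit Types (A B S U W X Z : {set V}) (L : {set {set V}}) (a b u v : V).

Definition cut S : {set V * V} := [set uv | [&& uv.1 \in S, uv.2 \notin S & e uv.1 uv.2]].

Definition separates S u v := (u \in S) != (v \in S).

(* Unlike the usual notion, this also requires [A :|: B != setT], which makes it
   invariant under complementing either set. *)
Definition crosses A B := [forall ab, [exists x, (x \in A, x \in B) == ab]].

Definition laminar L := {in L &, forall A B, [|| [disjoint A & B], A \subset B | B \subset A]}.

Definition min_cut S a b :=
  separates S a b && [forall X, separates X a b ==> (#|cut S| <= #|cut X|)].

Lemma cut_setC S : #|cut (~: S)| = #|cut S|.
Proof.
have swapI : injective (fun uv : V * V => (uv.2, uv.1)) by move=> [? ?] [? ?] [-> ->].
rewrite -(card_imset _ swapI); apply: eq_card => -[u v].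
apply/imsetP/idP => [[[u' v'] + [-> ->]]|].
  by rewrite !inE negbK /= e_sym => /and3P[-> ->].
rewrite inE /= => /and3P[uS vS euv]; exists (v, u) => //.
by rewrite !inE /= vS uS e_sym.
Qed.

Lemma cut_setT : cut setT = set0.
Proof. by apply/setP => uv; rewrite !inE. Qed.

Lemma cut_submodular A B : #|cut (A :&: B)| + #|cut (A :|: B)| <= #|cut A| + #|cut B|.
Proof.
have cutE S : #|cut S| = \sum_(uv : V * V) (uv \in cut S).
  by rewrite -sum1_card big_mkcond.
rewrite !cutE -!big_split; apply: leq_sum => -[u v] _; rewrite !inE /=.
by case: (u \in A); case: (u \in B); case: (v \in A); case: (v \in B); case: (e u v).
Qed.

Lemma separatesC S u v : separates S u v = separates S v u.
Proof. by rewrite /separates eq_sym. Qed.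

Lemma separates_setC S u v : separates (~: S) u v = separates S u v.
Proof. by rewrite /separates !inE (inj_eq negb_inj). Qed.

Lemma crossesP A B :
  reflect (forall a b : bool, exists x, (x \in A) = a /\ (x \in B) = b) (crosses A B).
Proof.
apply: (iffP forallP) => [AB a b|AB [a b]].
  by have /existsP[x /eqP[]] := AB (a, b); exists x.
by have [x [<- <-]] := AB a b; apply/existsP; exists x.
Qed.

Lemma crossesPn A B :
  reflect (exists a b : bool, forall x, (x \in A) = a -> (x \in B) = ~~ b) (~~ crosses A B).
Proof.
apply: (iffP forallPn) => [[[a b] /existsPn AB]|[a [b AB]]].
  exists a, b => x xA; have := AB x; rewrite xA xpair_eqE eqxx /=.
  by case: (x \in B); case: b {AB}.
exists (a, b); apply/existsPn => x; apply/negP => /eqP[/AB->].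
by case: b {AB}.
Qed.

Lemma crossesC A B : crosses A B = crosses B A.
Proof. by apply/crossesP/crossesP => AB a b; have [x []] := AB b a; exists x. Qed.

Lemma crosses_setCl A B : crosses (~: A) B = crosses A B.
Proof.
apply/crossesP/crossesP => AB a b; have [x [xA xB]] := AB (~~ a) b; exists x.
  by move: xA; rewrite inE => /negb_inj.
by rewrite inE xA negbK.
Qed.

Lemma crosses_setCr A B : crosses A (~: B) = crosses A B.
Proof. by rewrite crossesC crosses_setCl crossesC. Qed.

Lemma not_crosses_id A : ~~ crosses A A.
Proof. by apply/crossesPn; exists true, false => x ->. Qed.

Lemma not_crosses_subset A B : A \subset B -> ~~ crosses A B.
Proof. by move/subsetP=> AB; apply/crossesPn; exists true, false => x /AB. Qed.

Lemma min_cutP S a b :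
  reflect (separates S a b /\ forall X, separates X a b -> #|cut S| <= #|cut X|)
          (min_cut S a b).
Proof. by apply: (iffP andP) => -[sepS /forall_inP]. Qed.

Lemma min_cutC S a b : min_cut S a b = min_cut S b a.
Proof.
by rewrite /min_cut separatesC; under eq_forallb => X do rewrite separatesC.
Qed.

Lemma min_cut_setC S a b : min_cut (~: S) a b = min_cut S a b.
Proof. by rewrite /min_cut separates_setC cut_setC. Qed.

Lemma min_cut_exists X u v : separates X u v -> exists U, min_cut U u v.
Proof.
move=> sepX; have [U sepU U_min] :=
  @arg_minnP _ X (fun Y => separates Y u v) (fun Y => #|cut Y|) sepX.
by exists U; apply/min_cutP.
Qed.

Lemma min_cut_setI S U a b u v :
  min_cut S a b -> min_cut U u v -> separates (U :&: S) u v -> separates (U :|: S) a b ->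
  min_cut (U :&: S) u v.
Proof.
move=> /min_cutP[_ S_min] /min_cutP[_ U_min] sepI sepU; apply/min_cutP; split=> // X /U_min.
by have := S_min _ sepU; have := cut_submodular U S; lia.
Qed.

Lemma crosses_setI S U Z :
  crosses U S -> ~~ crosses Z S -> crosses (U :&: S) Z -> crosses U Z.
Proof.
move=> /crossesP US /crossesPn[z [s ZS]] /crossesP IZ; apply/crossesP => -[] y.
  by have [x []] := IZ true y; rewrite inE => /andP[]; exists x.
have {}ZS x : (x \in Z) = z -> x \in S.
  have [x0 []] := IZ true z; rewrite inE => /andP[_ x0S] /ZS; rewrite x0S => sE.
  by move/ZS; rewrite -sE => ->.
have [yz|yz] := eqVneq y z.
  have [x [+ xZ]] := IZ false z; rewrite inE ZS // andbT => xU.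
  by exists x; rewrite yz.
have [x [xU xS]] := US false false; exists x; split=> //.
by apply/eqP; apply: contraFT xS => xZ; apply: ZS; case: (x \in Z) y z yz xZ => -[] [].
Qed.

(* Up to complementing [S] and [U], both [u], [v] lie in [S] and [U :&: S] is the
   corner separating [u] from [v] whose opposite corner separates [a] from [b]. *)
Lemma uncross S U a b u v :
  min_cut S a b -> min_cut U u v -> ~~ separates S u v -> crosses U S ->
  exists W, [/\ min_cut W u v, ~~ crosses W S &
    forall Z, ~~ crosses Z S -> crosses W Z -> crosses U Z].
Proof.
wlog uS : S / u \in S => [main|].
  have [|uS] := boolP (u \in S); first exact: main.
  rewrite -(min_cut_setC S) -(separates_setC S) -(crosses_setCr U S) => mS mU sS US.
  have [|W [mW WS WZ]] := main _ _ mS mU sS US; first by rewrite inE.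
  by exists W; split=> // [|Z ZS]; [rewrite -crosses_setCr|apply: WZ; rewrite crosses_setCr].
wlog aS : a b / a \in S => [main|].
  have [|aS mS] := boolP (a \in S); first exact: main.
  have [+ _] := min_cutP _ _ _ mS; rewrite /separates (negPf aS) => bS.
  by apply: (main b a); rewrite 1?min_cutC //; case: (b \in S) bS.
wlog bU : U / b \notin U => [main|].
  have [|bU] := boolP (b \notin U); first exact: main.
  rewrite -(min_cut_setC U) -(crosses_setCl U S) => mS mU sS US.
  have [|W [mW WS WZ]] := main _ _ mS mU sS US; first by rewrite inE.
  by exists W; split=> // Z ZS /(WZ _ ZS); rewrite crosses_setCl.
move=> mS mU sS US; have [sepS _] := min_cutP _ _ _ mS; have [sepU _] := min_cutP _ _ _ mU.
have bS : b \notin S by move: sepS; rewrite /separates aS; case: (b \in S).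
have vS : v \in S by move: sS; rewrite /separates uS; case: (v \in S).
exists (U :&: S); split.
- apply: min_cut_setI mS mU _ _; first by rewrite /separates !inE uS vS !andbT.
  by rewrite /separates !inE aS (negPf bS) (negPf bU) orbT.
- by apply/not_crosses_subset/subsetIr.
by move=> Z ZS; apply: crosses_setI.
Qed.

Lemma noncrossing_min_cut L X u v :
  {in L &, forall A B, ~~ crosses A B} -> {in L, forall S, exists a b, min_cut S a b} ->
  {in L, forall S, ~~ separates S u v} -> separates X u v ->
  exists2 U, min_cut U u v & {in L, forall S, ~~ crosses U S}.
Proof.
move=> L_nc L_min L_nsep /min_cut_exists[U0 mU0].
have [U mU U_min] := @arg_minnP _ U0 (fun U => min_cut U u v)
  (fun U => #|[set S in L | crosses U S]|) mU0.
exists U => // S SL; apply/negP => US.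
have [a [b mS]] := L_min S SL.
have [W [mW WS WZ]] := uncross mS mU (L_nsep S SL) US.
have := U_min W mW; rewrite leqNgt => /negP; apply.
apply/proper_card/properP; split; last by exists S; rewrite !inE SL ?US // (negPf WS).
apply/subsetP => Z; rewrite !inE => /andP[ZL WcZ]; rewrite ZL /=.
by apply: WZ => //; apply: L_nc.
Qed.

Lemma noncrossing_cuts k : exists L,
  [/\ {in L &, forall A B, ~~ crosses A B}, {in L, forall S, #|cut S| < k} &
      forall u v X, {in L, forall S, ~~ separates S u v} -> separates X u v ->
        k <= #|cut X|].
Proof.
pose small S := (#|cut S| < k) && [exists ab, min_cut S ab.1 ab.2].
pose ok L := [forall A in L, small A && [forall B in L, ~~ crosses A B]].
have [|L /maxsetP[/forall_inP L_ok L_max]] := @ex_maxset _ ok.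
  by exists set0; apply/forall_inP => A; rewrite inE.
have L_nc : {in L &, forall A B, ~~ crosses A B}.
  by move=> A B /L_ok/andP[_ /forall_inP AL] /AL.
exists L; split=> // [S /L_ok/andP[/andP[]] //|u v X nsep sepX].
rewrite leqNgt; apply/negP => Xk.
have [|U mU U_nc] := noncrossing_min_cut L_nc _ nsep sepX.
  by move=> S /L_ok/andP[/andP[_ /existsP[[a b] mS]] _]; exists a, b.
have [sepU U_min] := min_cutP _ _ _ mU.
suff /L_max/(_ (subsetUr _ _)) LE : ok (U |: L).
  by move: (nsep U); rewrite -LE setU11 sepU => /(_ isT).
apply/forall_inP => A; rewrite in_setU1 => A_UL; apply/andP; split.
  case/predU1P: A_UL => [->|/L_ok/andP[]//]; rewrite /small (leq_ltn_trans (U_min X sepX) Xk).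
  by apply/existsP; exists (u, v).
apply/forall_inP => B; rewrite in_setU1 => B_UL.
case/predU1P: A_UL => [->|AL]; case/predU1P: B_UL => [->|BL].
- exact: not_crosses_id.
- exact: U_nc.
- by rewrite crossesC; apply: U_nc.
exact: L_nc.
Qed.

Lemma laminar_noncrossing L r :
  {in L &, forall A B, ~~ crosses A B} -> {in L, forall S, r \notin S} -> laminar L.
Proof.
move=> L_nc rL A B AL BL; have [a [b AB]] := crossesPn _ _ (L_nc _ _ AL BL).
have := AB r; rewrite (negPf (rL A AL)) (negPf (rL B BL)).
case: a b AB => [] [] AB rAB; last by have := rAB erefl.
- by rewrite disjoint_subset (_ : A \subset _) //; apply/subsetP => x /AB /negbT.
- by apply/or3P/Or32/subsetP => x /AB.
by apply/or3P/Or33/subsetP => x; apply: contraTT => /negPf/AB->.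
Qed.

Lemma laminar_cuts k : 0 < k -> exists L,
  [/\ setT \in L, laminar L, {in L, forall S, #|cut S| < k} &
      forall u v X, {in L, forall S, ~~ separates S u v} -> separates X u v ->
        k <= #|cut X|].
Proof.
move=> k_gt0; have [L [L_nc L_cut L_sep]] := noncrossing_cuts k.
have [r _|V0] := pickP V; last first.
  exists [set setT]; split=> [|A B _ _|S|u]; last by have := V0 u.
  - by rewrite set11.
  - by apply/or3P/Or32/subsetP => x; have := V0 x.
  by rewrite inE => /eqP->; rewrite cut_setT cards0.
pose avoid S := if r \in S then ~: S else S.
have crosses_avoid A B : crosses (avoid A) (avoid B) = crosses A B.
  by rewrite /avoid; case: ifP; case: ifP; rewrite ?crosses_setCl ?crosses_setCr.
exists (setT |: avoid @: L); split=> [|||u v X nsep].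
- by rewrite setU11.
- have lam : laminar (avoid @: L).
    apply: (@laminar_noncrossing _ r) => [_ _ /imsetP[A AL ->] /imsetP[B BL ->]|].
      by rewrite crosses_avoid L_nc.
    by move=> _ /imsetP[A _ ->]; rewrite /avoid; case: ifP => [|->//]; rewrite inE => ->.
  move=> A B /setU1P[->|AL] /setU1P[->|BL]; rewrite ?subsetT ?orbT //.
  exact: lam.
- move=> S /setU1P[->|/imsetP[A AL ->]]; first by rewrite cut_setT cards0.
  by rewrite /avoid; case: ifP; rewrite ?cut_setC L_cut.
apply: L_sep => S SL; have := nsep _ (setU1r _ (imset_f avoid SL)).
by rewrite /avoid; case: ifP; rewrite ?separates_setC.
Qed.
End Cuts.

(** * Flows and immersions *)

Section Steps.
Variable T : eqType.
Implicit Types (s : seq T) (R : rel T).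

Definition steps s : seq (T * T) := zip s (behead s).

Lemma sorted_steps R s : sorted R s = all (fun xy => R xy.1 xy.2) (steps s).
Proof. by case: s => // x s; rewrite /steps /=; elim: s x => //= y s IH x; rewrite IH. Qed.

Lemma mem_steps R s x y : sorted R s -> (x, y) \in steps s -> R x y.
Proof. by rewrite sorted_steps => /allP Rs /Rs. Qed.

Lemma steps_uniq s : uniq s -> uniq (steps s).
Proof. exact: zip_uniql. Qed.
End Steps.

Lemma sum_count_mem (T : finType) (A : {set T}) (s : seq T) :
  \sum_(x in A) count_mem x s = count [in A] s.
Proof.
elim: s => [|y s IH] /=; first by rewrite big1.
rewrite big_split /= IH; congr addn; case yA: (y \in A).
  by rewrite (bigD1 y) //= eqxx big1 // => x /andP[_ /negPf]; rewrite eq_sym => ->.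
by rewrite big1 // => x xA; case: eqP => // yx; rewrite yx xA in yA.
Qed.

Section Flow.
Import Order.TTheory GRing.Theory Num.Theory.
Local Open Scope ring_scope.
Variable V : finType.
Implicit Types (e : rel V) (f : V -> V -> int) (X : {set V}) (s u v : V) (p ds : seq V).

Definition is_flow e f :=
  (forall u v, f u v = - f v u) /\ (forall u v, f u v <= (e u v)%:Z).

Definition net f v := \sum_w f v w.

Definition residual e f : rel V := [rel x y | f x y < (e x y)%:Z].

Lemma net_cut e f X : is_flow e f ->
  \sum_(v in X) net f v = \sum_(v in X) \sum_(w in ~: X) f v w.
Proof.
move=> [skew _].
have netE v : net f v = \sum_(w in X) f v w + \sum_(w in ~: X) f v w.
  rewrite /net (bigID [in X]) /=; congr (_ + _).
  by apply: eq_bigl => w; rewrite inE.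
under eq_bigr => v _ do rewrite netE.
rewrite big_split /=; set inner := \sum_(v in X) _.
suff -> : inner = 0 by rewrite add0r.
have : inner = - inner.
  rewrite {1}/inner exchange_big /= -sumrN; apply: eq_bigr => v _.
  by rewrite -sumrN; apply: eq_bigr => w _; rewrite -skew.
lia.
Qed.

Lemma net_saturated_cut e f X : is_flow e f ->
  {in X & ~: X, forall v w, ~~ residual e f v w} ->
  \sum_(v in X) net f v = #|cut e X|%:Z.
Proof.
move=> flow_f saturated; rewrite (net_cut _ flow_f) -sum1_card.
rewrite (eq_bigl (fun uv : V * V => (uv.1 \in X) && ((uv.2 \in ~: X) && e uv.1 uv.2)));
  last by move=> [u w]; rewrite !inE.
rewrite -(pair_big_dep [in X] (fun u w => (w \in ~: X) && e u w) (fun _ _ => 1%N)) /=.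
rewrite (big_morph Posz PoszD (erefl _)); apply: eq_bigr => u uX.
rewrite big_mkcondr /= (big_morph Posz PoszD (erefl _)); apply: eq_bigr => w wX.
by have := flow_f.2 u w; have := saturated u w uX wX; rewrite /residual /=; case: (e u w); lia.
Qed.

Definition path_flow p x y : int :=
  (count_mem (x, y) (steps p))%:Z - (count_mem (y, x) (steps p))%:Z.

Lemma net_path_flow u p v : net (path_flow (u :: p)) v = (v == u)%:Z - (v == last u p)%:Z.
Proof.
have sum_indicator (b : bool) z : \sum_w (b && (w == z))%:Z = b%:Z.
  rewrite (bigD1 z) //= eqxx andbT big1 ?addr0 // => w /negPf ->.
  by rewrite andbF.
elim: p u => [|x p IH] u; first by rewrite /net big1 // subrr.
have path_flow_cons w : path_flow (u :: x :: p) v w =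
    (((v == u) && (w == x))%:Z - ((v == x) && (w == u))%:Z) + path_flow (x :: p) v w.
  rewrite /path_flow /steps /= !xpair_eqE !PoszD ![u == _]eq_sym ![x == _]eq_sym.
  by rewrite [(w == u) && _]andbC; ring.
rewrite /net; under eq_bigr => w _ do rewrite path_flow_cons.
by rewrite big_split /= sumrB !sum_indicator -/(net _ v) IH; ring.
Qed.

Lemma net_add_path_flow f u p v :
  net (fun x y => f x y + path_flow (u :: p) x y) v =
  net f v + ((v == u)%:Z - (v == last u p)%:Z).
Proof. by rewrite -net_path_flow /net big_split. Qed.

Lemma net_sub_path_flow f u p v :
  net (fun x y => f x y - path_flow (u :: p) x y) v =
  net f v - ((v == u)%:Z - (v == last u p)%:Z).
Proof. by rewrite -net_path_flow /net sumrB. Qed.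

Lemma path_flowE p x y : uniq p ->
  path_flow p x y = ((x, y) \in steps p)%:Z - ((y, x) \in steps p)%:Z.
Proof. by move=> uniq_p; rewrite /path_flow !count_uniq_mem // steps_uniq. Qed.

Lemma path_flow_skew p x y : path_flow p x y = - path_flow p y x.
Proof. by rewrite opprB. Qed.

Lemma is_flow_augment e f p : is_flow e f -> sorted (residual e f) p -> uniq p ->
  is_flow e (fun x y => f x y + path_flow p x y).
Proof.
move=> [skew cap] res_p uniq_p; split=> x y; first by rewrite skew path_flow_skew; lia.
rewrite path_flowE //; have := mem_steps (x := x) (y := y) res_p; have := cap x y.
by rewrite /residual /=; case: ((x, y) \in _); case: ((y, x) \in _); lia.
Qed.

Definition delete_steps e p : rel V :=
  [rel x y | [&& e x y, (x, y) \notin steps p & (y, x) \notin steps p]].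

Lemma delete_steps_sym e p : symmetric e -> symmetric (delete_steps e p).
Proof. by move=> e_sym x y; rewrite /delete_steps /= e_sym [(_ \notin _) && _]andbC. Qed.

Lemma is_flow_delete e f p : is_flow e f -> sorted (fun x y => 0 < f x y) p -> uniq p ->
  is_flow (delete_steps e p) (fun x y => f x y - path_flow p x y).
Proof.
move=> [skew cap] pos_p uniq_p; split=> x y; first by rewrite skew path_flow_skew; lia.
rewrite path_flowE //; have := mem_steps (x := x) (y := y) pos_p.
have := mem_steps (x := y) (y := x) pos_p; have := cap x y; have := skew y x.
rewrite /delete_steps /=; case: ((x, y) \in _); case: ((y, x) \in _) => //=.
- by move=> ? ? /(_ isT) ? /(_ isT); case: (e x y); lia.
- by move=> ? ? _ /(_ isT); rewrite andbF; case: (e x y); lia.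
- by move=> ? ? /(_ isT) ? _; rewrite andbF; case: (e x y); lia.
by move=> *; rewrite andbT; lia.
Qed.

Definition supplies e s ds f :=
  is_flow e f /\ forall v, net f v = (size ds * (v == s))%:Z - (count_mem v ds)%:Z.

Lemma sum_net_supplies e s ds f X : supplies e s ds f -> s \in X ->
  \sum_(v in X) net f v = (count [predC X] ds)%:Z.
Proof.
move=> [_ netE] sX; under eq_bigr => v _ do rewrite netE.
rewrite sumrB -!(big_morph Posz PoszD (erefl _)) sum_count_mem (bigD1 s) //= eqxx muln1.
rewrite big1 => [|v /andP[_ /negPf->]]; last by rewrite muln0.
by rewrite -(count_predC [in X] ds) /=; lia.
Qed.

Lemma max_flow e s ds :
  (forall X, s \in X -> (count [predC X] ds <= #|cut e X|)%N) ->
  exists f, supplies e s ds f.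
Proof.
elim: ds => [|d ds IH] cutP.
  exists (fun _ _ => 0); split=> [|v]; first by split=> u v; lia.
  by rewrite /net big1 //; lia.
have [X sX|f sup_f] := IH; first by have := cutP X sX; rewrite /=; lia.
have /connectP[_ /shortenP[p res_p uniq_p _] dE] : connect (residual e f) s d.
  apply: contrapT => /negP not_sd; pose R := [set x | connect (residual e f) s x].
  have sR : s \in R by rewrite inE connect0.
  suff saturated : {in R & ~: R, forall v w, ~~ residual e f v w}.
    have := net_saturated_cut sup_f.1 saturated; rewrite (sum_net_supplies sup_f sR).
    by have := cutP R sR; rewrite /= inE not_sd; lia.
  move=> v w; rewrite !inE => sv; apply: contra => vw.
  exact: connect_trans sv (connect1 vw).
exists (fun x y => f x y + path_flow (s :: p) x y); split=> [|v].
  by apply: is_flow_augment => //; case: sup_f.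
by rewrite net_add_path_flow -dE sup_f.2 /= [d == v]eq_sym; lia.
Qed.

Lemma flow_decomposition (J : eqType) (d : J -> V) (js : seq J) e s f :
  symmetric e -> supplies e s (map d js) f ->
  exists2 g : V -> V -> option J, forall x y, g x y = g y x &
    {in js, forall j, connect [rel x y | e x y && (g x y == Some j)] s (d j)}.
Proof.
elim: js e f => [|j js IH] e f e_sym sup_f; first by exists (fun _ _ => None).
have /connectP[_ /shortenP[p pos_p uniq_p _] djE] : connect (fun x y => 0 < f x y) s (d j).
  apply: contrapT => /negP not_sd; pose R := [set x | connect (fun x y => 0 < f x y) s x].
  have sR : s \in R by rewrite inE connect0.
  suff : \sum_(v in R) net f v <= 0.
    by rewrite (sum_net_supplies sup_f sR) /= inE not_sd; lia.
  rewrite (net_cut _ sup_f.1); apply: sumr_le0 => v vR; apply: sumr_le0 => w.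
  rewrite !inE in vR * => wR; rewrite leNgt; apply: contra wR => vw.
  exact: connect_trans vR (connect1 vw).
pose e' := delete_steps e (s :: p).
have e'_sym : symmetric e' by apply: delete_steps_sym.
have sup_f' : supplies e' s (map d js) (fun x y => f x y - path_flow (s :: p) x y).
  split=> [|v]; first by apply: is_flow_delete => //; case: sup_f.
  by rewrite net_sub_path_flow -djE sup_f.2 /= [d j == v]eq_sym; lia.
have [g g_sym g_path] := IH e' _ e'_sym sup_f'.
exists (fun x y => if e' x y then g x y else Some j) => [x y|i]; first by rewrite e'_sym g_sym.
rewrite inE => /predU1P[->|/g_path]; last first.
  apply: connect_sub => x y /andP[e'xy gxy]; apply: connect1.
  by rewrite /= e'xy gxy andbT; case/andP: e'xy.
rewrite djE; apply/connectP; exists p => //; rewrite -/(sorted _ (s :: p)) sorted_steps.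
apply/allP => -[x y] xy_p /=.
have := mem_steps (s := s :: p) pos_p xy_p; have := sup_f.1.2 x y.
by rewrite /e' /delete_steps /= xy_p !andbF eqxx; case: (e x y); lia.
Qed.

Lemma edge_disjoint_fan (J : finType) (d : J -> V) e s : symmetric e ->
  (forall X, s \in X -> (#|[set j | d j \notin X]| <= #|cut e X|)%N) ->
  exists2 g : V -> V -> option J, forall x y, g x y = g y x &
    forall j, connect [rel x y | e x y && (g x y == Some j)] s (d j).
Proof.
move=> e_sym cutP.
have [X sX|f sup_f] := @max_flow e s (map d (enum J)).
  apply: leq_trans (cutP X sX); rewrite count_map -sum1_count big_enum_cond sum1_card.
  by apply/subset_leq_card/subsetP => j; rewrite inE.
have [g g_sym g_path] := flow_decomposition e_sym sup_f.
by exists g => // j; apply: g_path; rewrite mem_enum.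
Qed.
End Flow.

Lemma set2_inj (T : finType) (a b c d : T) : [set a; b] = [set c; d] ->
  (a = c /\ b = d) \/ (a = d /\ b = c).
Proof.
move=> E.
have /set2P ac : a \in [set c; d] by rewrite -E set21.
have /set2P bc : b \in [set c; d] by rewrite -E set22.
have /set2P ca : c \in [set a; b] by rewrite E set21.
have /set2P da : d \in [set a; b] by rewrite E set22.
by case: ac bc ca da => [] ? [] ? [] ? [] ?; subst; auto.
Qed.

Lemma path_edgesP (G : sgraph) (R : rel G) (p : seq G) (E : {set G}) :
  sorted R p -> E \in path_edges p -> exists x y, R x y /\ E = [set x; y].
Proof. by move=> Rp /mapP[[x y] xy ->]; exists x, y; split=> //; apply: mem_steps xy. Qed.

Lemma immersion_of_edge_labelling (G H : sgraph) (f : H -> G)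
    (lab : G -> G -> option {set H}) :
  injective f -> (forall x y, lab x y = lab y x) ->
  (forall v w, adj v w ->
     connect [rel x y | adj x y && (lab x y == Some [set v; w])] (f v) (f w)) ->
  contains_immersion G H.
Proof.
move=> f_inj lab_sym lab_path.
pose R (A : {set H}) := [rel x y : G | adj x y && (lab x y == Some A)].
have /choice[P PP] : forall A : {set H}, exists p : seq G, forall v w : H, adj v w ->
    A = [set v; w] -> path_between (f v) (f w) p /\ sorted (R A) p.
  move=> A.
  have [[v w] /= /andP[vw /eqP AE]|none] :=
      pickP (fun vw : H * H => adj vw.1 vw.2 && (A == [set vw.1; vw.2])); last first.
    by exists [::] => v w vw AE; have := none (v, w); rewrite /= vw AE eqxx.
  have /connectP[_ /shortenP[p Rp uniq_p _] fwE] := lab_path _ _ vw.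
  have path_p : is_path (f v :: p).
    by apply/and3P; split=> //; apply: sub_path Rp => x y /andP[].
  exists (f v :: p) => v' w' _; rewrite AE => /set2_inj[] [<- <-]; split=> //; split=> //.
    by left.
  by right.
exists f, P; split=> // [v w vw|A B]; first by have [] := PP _ v w vw erefl.
case/imsetP=> -[v w]; rewrite inE => vw AE; case/imsetP=> -[v' w']; rewrite inE => vw' BE AB.
have [_ RA] := PP A v w vw AE; have [_ RB] := PP B v' w' vw' BE.
rewrite disjoint_has; apply/hasPn => E /(path_edgesP RA)[x [y [/andP[_ /eqP labA] ->]]].
apply/negP => /(path_edgesP RB)[x' [y' [/andP[_ /eqP labB] /set2_inj xy]]].
have : Some A = Some B.
  by case: xy => [] [xE yE]; move: labA labB; rewrite xE yE 1?lab_sym => -> ->.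
by case=> /eqP; apply/negP.
Qed.

(* The image of an edge [vw] of [H] joins a path from [f h] to [f v] with one from
   [f h] to [f w], out of a fan of edge-disjoint paths from a fixed [f h]. *)
Lemma immersion_of_edge_connected (G H : sgraph) (f : H -> G) : injective f ->
  (forall i j (X : {set G}), separates X (f i) (f j) -> #|H| ^ 2 <= #|cut (@adj G) X|) ->
  contains_immersion G H.
Proof.
move=> f_inj conn.
have [h _|H0] := pickP H; last first.
  by apply: (@immersion_of_edge_labelling G H f (fun _ _ => None)) => // v; have := H0 v.
have [X hX|g g_sym g_path] :=
  @edge_disjoint_fan G _ (fun ij : H * H => f ij.1) _ (f h) (@adj_sym G).
  have [->|[[i j]]] := set_0Vmem [set ij : H * H | f ij.1 \notin X]; first by rewrite cards0.
  rewrite inE /= => iX; apply: leq_trans (max_card _) _; rewrite card_prod mulnn.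
  by apply: (conn h i); rewrite /separates hX (negPf iX).
pose lab x y := omap (fun ij : H * H => [set ij.1; ij.2]) (g x y).
have lab_sym x y : lab x y = lab y x by rewrite /lab g_sym.
apply: (immersion_of_edge_labelling f_inj lab_sym) => v w _.
set R := (X in connect X).
have R_sym : symmetric R by move=> x y; rewrite /R /= adj_sym lab_sym.
have hub i j : [set i; j] = [set v; w] -> connect R (f h) (f i).
  move=> ij; apply: connect_sub (g_path (i, j)) => x y /andP[xy /eqP gxy].
  by apply: connect1; rewrite /R /= xy /lab gxy /= ij.
apply: connect_trans (hub w v _); last by rewrite setUC.
by rewrite (sym_connect_sym R_sym); apply: hub.
Qed.

Lemma immersion_of_edge_connected_set (G H : sgraph) (B : {set G}) : #|H| <= #|B| ->
  {in B &, forall u v X, separates X u v -> #|H| ^ 2 <= #|cut (@adj G) X|} ->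
  contains_immersion G H.
Proof.
move=> HB conn.
apply: (@immersion_of_edge_connected G H (fun i => enum_val (widen_ord HB (enum_rank i)))).
  by move=> i j /enum_val_inj/(congr1 val)/= E; apply/enum_rank_inj/val_inj.
by move=> i j X; apply: conn; apply: enum_valP.
Qed.

(** * Colouring along a laminar family *)

Definition set_rank (T : finType) (S : {set T}) : nat :=
  index S (sort (fun A B : {set T} => #|B| <= #|A|) (enum {set T})).

Lemma set_rank_inj (T : finType) : injective (@set_rank T).
Proof. by move=> S S' /(index_inj set0); apply; rewrite mem_sort mem_enum. Qed.

Lemma set_rank_subset (T : finType) (S S' : {set T}) :
  S \subset S' -> set_rank S' <= set_rank S.
Proof.
move=> SS'; rewrite leqNgt; apply/negP => lt; suff SE : S = S' by rewrite SE ltnn in lt.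
apply/eqP; rewrite eqEcard SS' /=.
have geq_card_trans : transitive (fun A B : {set T} => #|B| <= #|A|).
  by move=> B A C leBA leCB; exact: leq_trans leCB leBA.
apply: (sorted_ltn_index geq_card_trans) lt; rewrite ?mem_sort ?mem_enum //.
by apply: sort_sorted => A B; exact: leq_total.
Qed.

Section LaminarColouring.
Variables (V : finType) (e : rel V) (L : {set {set V}}) (k b : nat).
Hypothesis e_sym : symmetric e.
Hypothesis e_irr : irreflexive e.
Hypothesis k_gt0 : 0 < k.
Hypothesis LT : setT \in L.
Hypothesis L_laminar : laminar L.
Hypothesis L_cut : {in L, forall S, #|cut e S| < k}.

Definition bag (S : {set V}) : {set V} :=
  [set v in S | [forall Y in L, (v \in Y) ==> (S \subset Y)]].

Hypothesis bag_le : forall S, #|bag S| <= b.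

Lemma bag_not_separated S : {in bag S &, forall u v, {in L, forall Y, ~~ separates Y u v}}.
Proof.
have bag_sub u v Y : u \in bag S -> v \in bag S -> Y \in L -> u \in Y -> v \in Y.
  rewrite !inE => /andP[_ /forall_inP ub] /andP[vS _] YL uY.
  by have /implyP/(_ uY)/subsetP := ub Y YL; apply.
move=> u v uS vS Y YL; rewrite negbK; apply/eqP.
by apply/idP/idP; apply: bag_sub.
Qed.

Lemma laminar_comparable A B x : A \in L -> B \in L -> x \in A -> x \in B ->
  A \subset B \/ B \subset A.
Proof.
move=> AL BL xA xB; have /or3P[/pred0P/(_ x)|AB|BA] := L_laminar AL BL; [|by left|by right].
by rewrite /= xA xB.
Qed.

Definition closed_nbhd v : {set V} := v |: [set w | e v w].

Definition home v : {set V} :=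
  [arg min_(S < setT | (S \in L) && (closed_nbhd v \subset S)) #|S|].

Lemma homeP v : [/\ home v \in L, closed_nbhd v \subset home v &
  forall S, S \in L -> closed_nbhd v \subset S -> home v \subset S].
Proof.
rewrite /home; case: arg_minnP => [|S /andP[SL NS] Smin]; first by rewrite LT subsetT.
split=> // Y YL NY; have vN : v \in closed_nbhd v by rewrite !inE eqxx.
have [//|YS] := laminar_comparable SL YL (subsetP NS _ vN) (subsetP NY _ vN).
have /eqP-> // : Y == S by rewrite eqEcard YS Smin // YL.
Qed.

Lemma mem_home v : v \in home v.
Proof. by have [_ /subsetP-> //] := homeP v; rewrite !inE eqxx. Qed.

Lemma adj_home u v : e v u -> u \in home v.
Proof. by have [_ /subsetP sub _] := homeP v => evu; apply: sub; rewrite !inE evu orbT. Qed.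

Definition boundary (S : {set V}) : {set V} := [set v in S | ~~ (closed_nbhd v \subset S)].

Lemma boundary_cut (S : {set V}) : #|boundary S| <= #|cut e S|.
Proof.
apply: leq_trans (leq_imset_card (fun uv : V * V => uv.1) (cut e S)).
apply/subset_leq_card/subsetP => v.
rewrite inE => /andP[vS /subsetPn[w]]; rewrite !inE => /predU1P[->|evw wS].
  by rewrite vS.
by apply/imsetP; exists (v, w) => //; rewrite inE /= vS wS.
Qed.

Lemma boundary_subset_home v (S : {set V}) : S \in L -> v \in boundary S -> S \subset home v.
Proof.
move=> SL; rewrite inE => /andP[vS nNS]; have [hL hN _] := homeP v.
have [hS|//] := laminar_comparable hL SL (mem_home v) vS.
by move/negP: nNS; case; apply: subset_trans hN hS.
Qed.

Lemma mem_boundary v (S : {set V}) :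
  S \in L -> v \in S -> ~~ (home v \subset S) -> v \in boundary S.
Proof.
move=> SL vS hS; rewrite inE vS; apply: contra hS => NS.
by have [_ _] := homeP v; apply.
Qed.

Definition filled : rel V := [rel u v | (u != v) &&
  (e u v || [exists S in L, (u \in boundary S) && (v \in boundary S)])].

Lemma filled_sym : symmetric filled.
Proof.
move=> u v; rewrite /filled /= eq_sym e_sym; congr (_ && (_ || _)).
by apply: eq_existsb => S; rewrite [(u \in _) && _]andbC.
Qed.

Local Notation block v := (set_rank (home v)).

Lemma backnbrs_boundary v :
  backnbrs (fun v => block v) filled (block v) \subset boundary (home v).
Proof.
apply/subsetP => u; rewrite inE => /andP[lt /existsP[w /andP[/eqP/set_rank_inj wv fuw]]].
rewrite -wv in lt *; have [hw _ _] := homeP w.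
apply: mem_boundary => //; last by apply: contraL lt => /set_rank_subset; rewrite -leqNgt.
have /andP[_ /orP[euw|/existsP[S /and3P[SL uS wS]]]] := fuw.
  by apply: adj_home; rewrite e_sym.
by apply: (subsetP (boundary_subset_home SL wS)); move: uS; rewrite inE => /andP[].
Qed.

Lemma filled_clique_blocks : clique_blocks (fun v => block v) filled k.
Proof.
move=> z; have [v /eqP<-|none] := pickP (fun v => block v == z).
  have [hv _ _] := homeP v; split=> [|u w].
    apply: leq_trans (subset_leq_card (backnbrs_boundary v)) _.
    by apply: leq_trans (boundary_cut _) (ltnW (L_cut hv)).
  move=> /(subsetP (backnbrs_boundary v)) ub /(subsetP (backnbrs_boundary v)) wb uw.
  by rewrite /filled /= uw; apply/orP; right; apply/existsP; exists (home v); rewrite hv ub wb.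
suff -> : backnbrs (fun v => block v) filled z = set0.
  by rewrite cards0; split=> // u v; rewrite inE.
by apply/setP => u; rewrite !inE; apply/negP => /andP[_ /existsP[v]]; rewrite none.
Qed.

(* Let [Y] be the largest member of [L] through [v] not containing [home v]. The
   neighbours of [v] in its block lie on the boundary of [Y], or are joined to [v]
   by an edge leaving [Y]. *)
Lemma filled_degree v : v \notin bag (home v) ->
  #|[set w | (home w == home v) && filled v w]| <= 2 * k.
Proof.
rewrite inE mem_home /= => /forall_inPn[Y0 Y0L]; rewrite negb_imply => /andP[vY0 hY0].
pose P (Y : {set V}) := [&& Y \in L, v \in Y & ~~ (home v \subset Y)].
have P0 : P Y0 by rewrite /P Y0L vY0.
have [Y /and3P[YL vY hY] Ymax] := @arg_maxnP _ Y0 P (fun Y : {set V} => #|Y|) P0.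
apply: (@leq_trans #|boundary Y :|: [set w | (w \notin Y) && e v w]|).
  apply/subset_leq_card/subsetP => w; rewrite inE => /andP[/eqP hw fvw].
  have in_boundary : w \in Y -> w \in boundary Y.
    by move=> wY; apply: mem_boundary; rewrite ?hw.
  rewrite in_setU [w \in [set _ | _]]inE; apply/orP.
  have [/in_boundary|wY] := boolP (w \in Y); first by left.
  have /andP[_ /orP[|/existsP[Z /and3P[ZL]]]] := fvw; first by right.
  rewrite ![_ \in boundary Z]inE => /andP[vZ nNZ] /andP[wZ _].
  have hZ : ~~ (home v \subset Z).
    by apply: contra nNZ; apply: subset_trans; have [] := homeP v.
  have [ZY|YZ] := laminar_comparable ZL YL vZ vY; first by rewrite (subsetP ZY _ wZ) in wY.
  have /eqP YE : Y == Z by rewrite eqEcard YZ; apply: Ymax; apply/and3P.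
  by rewrite YE wZ in wY.
have boundary_le : #|boundary Y| <= k by apply: leq_trans (boundary_cut _) (ltnW (L_cut YL)).
suff : #|[set w | (w \notin Y) && e v w]| <= k.
  by have := (leq_card_setU (boundary Y) [set w | (w \notin Y) && e v w]).1; lia.
apply: leq_trans (ltnW (L_cut YL)).
have pair_inj : injective (pair v : V -> V * V) by move=> ? ? [].
rewrite -(card_imset _ pair_inj); apply/subset_leq_card/subsetP => _ /imsetP[w + ->].
by rewrite !inE vY.
Qed.

Lemma block_nonrep_colourable (z : nat) : nonrep_colourable filled [pred v | block v == z]
  (b + (4 * (2 * k) ^ 2 + 4 * (2 * k))).
Proof.
have [v /eqP vz|none] := pickP (fun v => block v == z); last first.
  have c_gt0 : 0 < b + (4 * (2 * k) ^ 2 + 4 * (2 * k)) by lia.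
  exists (fun=> Ordinal c_gt0) => -[//|x q] r _ _ _ /(_ x (mem_head _ _)).
  by rewrite inE none.
have [|psi nr] := @nonrep_colourable_exceptions _ filled [pred w | block w == z] (bag (home v))
    (4 * (2 * k) ^ 2 + 4 * (2 * k)).
  apply: bounded_degree_nonrep_colourable; [exact: filled_sym|lia|].
  move=> w /andP[/= wB]; rewrite inE -vz => /eqP/set_rank_inj hw.
  rewrite -hw in wB; apply: leq_trans (filled_degree wB).
  apply/subset_leq_card/subsetP => x; rewrite !inE -hw.
  by move=> /andP[/andP[_ /eqP/set_rank_inj->] ->]; rewrite eqxx.
by apply: nonrep_colourable_card nr; rewrite card_ord leq_add2r.
Qed.

Lemma laminar_nonrep_colourable :
  nonrep_colourable e predT (72 ^ k.+1 * (b + (4 * (2 * k) ^ 2 + 4 * (2 * k)))).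
Proof.
have [psi nr] := clique_blocks_nonrep_colourable filled_sym filled_clique_blocks
  block_nonrep_colourable.
exists psi; apply: nonrep_on_sub nr => // u v _ _ euv.
by rewrite /filled /= euv andbT; apply: contraTneq euv => ->; rewrite e_irr.
Qed.
End LaminarColouring.

Lemma colour_count_bound (b k : nat) : 0 < k -> b <= k ->
  72 ^ k.+1 * (b + (4 * (2 * k) ^ 2 + 4 * (2 * k))) <= 4 ^ (12 * k).
Proof.
move=> k_gt0 bk.
have -> : 4 ^ (12 * k) = (4 ^ 4) ^ k * ((4 ^ 6) ^ k * (4 ^ k * 4 ^ k)).
  by rewrite -!expnM -!expnD; congr (4 ^ _); lia.
rewrite expnSr -mulnA; apply: leq_mul; first by rewrite leq_exp2r.
have : k < 4 ^ k by rewrite ltn_expl.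
have : 4 ^ 6 <= (4 ^ 6) ^ k by rewrite -{1}(expn1 (4 ^ 6)) leq_exp2l.
by move: ((4 ^ 6) ^ k) (4 ^ k) => x y; rewrite -!mulnn; nia.
Qed.

Theorem theorem3 :
  exists C : nat, 0 < C /\
    forall (t : nat) (H : sgraph), #|H| = t ->
    forall G : sgraph, ~ contains_immersion G H ->
      nonrepetitively_colourable G (4 ^ (t ^ 4 + C * t ^ 2)).
Proof.
exists 12; split=> // t H cardH G noH.
have t_gt0 : 0 < t.
  rewrite lt0n; apply/eqP => t0; apply: noH.
  by apply: (@immersion_of_edge_connected_set G H set0) => [|u v]; rewrite ?cardH ?t0 // inE.
have k_gt0 : 0 < t ^ 2 by rewrite expn_gt0 t_gt0.
have [L [LT L_laminar L_cut L_sep]] := laminar_cuts (@adj_sym G) k_gt0.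
have bag_le S : #|bag L S| <= t.
  rewrite leqNgt; apply/negP => lt; apply: noH.
  apply: (@immersion_of_edge_connected_set G H (bag L S)); rewrite cardH; first exact: ltnW.
  by move=> u v uS vS X; apply: L_sep; apply: bag_not_separated uS vS.
apply: nonrep_colourable_sgraph.
have [psi nr] := laminar_nonrep_colourable (@adj_sym G) (@adj_irr G) k_gt0
  LT L_laminar L_cut bag_le.
apply: nonrep_colourable_card nr; rewrite card_ord.
apply: leq_trans (colour_count_bound k_gt0 _) _; first by rewrite -mulnn leq_pmulr.
by rewrite leq_exp2l // leq_addl.
Qed.
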